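(* Let $\lambda=(\lambda_n)_{n\ge1}\in W_0$, put $\Lambda_n:=\lambda_1+\cdots+\lambda_n$, and assume that $\Lambda_n\to\infty$ and that $(\lambda_n/\Lambda_n)_{n\ge1}$ is nonincreasing with limit $\eta\in[0,1)$. Let $p,q\in\mathbb{R}$ with $\min(p,q)\le0\le\max(p,q)<1$. Then $$\mathscr{H}_\lambda(\mathscr{G}_{p,q})=\begin{cases}\left(\dfrac{1-(1-\eta)^{1-q}}{1-(1-\eta)^{1-p}}\right)^{\frac1{p-q}}, & \eta\in(0,1)\text{ and }p\ne q;\\[3mm]\left(\dfrac{1-q}{1-p}\right)^{\frac1{p-q}}, & \eta=0\text{ and }p\ne q;\\[3mm](1-\eta)^{1-1/\eta}, & \eta\in(0,1)\text{ and }p=q=0;\\[1mm]e, & \eta=0\text{ and }p=q=0.\end{cases}$$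
   Context: $W_n$ is the set of $(\lambda_1,\dots,\lambda_n)\in\mathbb{R}^n$ with all $\lambda_i\ge0$ and $\lambda_1+\cdots+\lambda_n>0$; $W_0$ is the set of real sequences $(\lambda_n)_{n\ge1}$ with $\lambda_1>0$ and $\lambda_n\ge0$ for $n\ge2$. The weighted Gini mean $\mathscr{G}_{p,q}\colon\bigcup_{n\ge1}(0,\infty)^n\times W_n\to(0,\infty)$ is $$\mathscr{G}_{p,q}(x,\lambda):=\begin{cases}\left(\dfrac{\lambda_1x_1^p+\cdots+\lambda_nx_n^p}{\lambda_1x_1^q+\cdots+\lambda_nx_n^q}\right)^{\frac1{p-q}}, & p\ne q,\\[3mm]\exp\left(\dfrac{\lambda_1x_1^p\log x_1+\cdots+\lambda_nx_n^p\log x_n}{\lambda_1x_1^p+\cdots+\lambda_nx_n^p}\right), & p=q.\end{cases}$$ Hardy constant: $\mathscr{H}_\lambda(\mathscr{G}_{p,q})$ is the smallest extended real number $C$ such that $\sum_{n=1}^\infty\lambda_n\,\mathscr{G}_{p,q}\big((x_1,\dots,x_n),(\lambda_1,\dots,\lambda_n)\big)\le C\sum_{n=1}^\infty\lambda_nx_n$ for all sequences $(x_n)$ in $(0,\infty)$. *)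

(* Defs.v *)
From mathcomp Require Import all_boot all_order all_algebra.
From mathcomp Require Import all_classical all_reals all_analysis.

Set Implicit Arguments.
Unset Strict Implicit.
Unset Printing Implicit Defensive.

Import Order.TTheory GRing.Theory Num.Theory.
Import numFieldNormedType.Exports.

Local Open Scope classical_set_scope.
Local Open Scope ring_scope.

(* Sequences are indexed from 0: the term written lambda_{n+1} in the
   one-based convention is [lam n]. *)

Definition W0 (R : realType) : set (nat -> R) :=
  [set lam | 0 < lam 0%N /\ forall n, 0 <= lam n].

Definition partial_weight (R : realType) (lam : nat -> R) (n : nat) : R :=
  \sum_(i < n.+1) lam i.

(* Only meaningful when all x_i > 0, all lam_i >= 0 and \sum_i lam_i > 0; the
   sums, quotients and powers below are then positive. *)
Definition gini_mean (R : realType) (p q : R) (n : nat)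
    (x lam : 'I_n -> R) : R :=
  if p == q then
    expR ((\sum_(i < n) lam i * x i `^ p * ln (x i)) /
          (\sum_(i < n) lam i * x i `^ p))
  else
    ((\sum_(i < n) lam i * x i `^ p) / (\sum_(i < n) lam i * x i `^ q))
      `^ (p - q)^-1.

(* Both series have nonnegative terms, so their sums exist in [0, +oo]; when
   the right-hand one diverges, any C > 0 makes the inequality hold. *)
Definition hardy_bounds (R : realType)
    (M : forall n : nat, ('I_n -> R) -> ('I_n -> R) -> R)
    (lam : nat -> R) : set (\bar R) :=
  [set C | forall x : nat -> R, (forall n, 0 < x n) ->
    (\sum_(0 <= n <oo)
        (lam n * M n.+1 (fun i => x i) (fun i => lam i))%:E
     <= C * \sum_(0 <= n <oo) (lam n * x n)%:E)%E].

Definition is_hardy_constant (R : realType)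
    (M : forall n : nat, ('I_n -> R) -> ('I_n -> R) -> R)
    (lam : nat -> R) (C : \bar R) : Prop :=
  hardy_bounds M lam C /\ lbound (hardy_bounds M lam) C.

(* Main.v *)
(* Upper bound. With [A_n] the weighted mean of the [a_i] and [s = 1 / q], an
   Elliott-type argument (Young's inequality plus a telescoping term
   [Lam_n * A_n ^ s]) gives the sharp weighted Hardy inequality for the power
   mean of exponent [q]; it only uses [lam_n / Lam_n >= eta]. The Gini mean is
   the weighted geometric mean [P_q ^ th * P_p ^ (1 - th)] of two power means,
   where [th = q / (q - p)], so AM-GM combines both inequalities, and the
   constants multiply to the Gini constant.

   Lower bound. For [x_i = 1 / Lam_i], cut off summably beyond [n], two
   applications of the Stolz-Cesaro theorem compute the limit of
   [Lam_n * G_n(x)] and of the ratio of the partial sums of both sides. *)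
Require Import Defs.
From mathcomp Require Import all_boot all_order all_algebra.
From mathcomp Require Import all_classical all_reals all_analysis.
From mathcomp Require Import ring lra.

Set Implicit Arguments.
Unset Strict Implicit.
Unset Printing Implicit Defensive.

Import Order.TTheory GRing.Theory Num.Theory.
Import numFieldNormedType.Exports.

Local Open Scope classical_set_scope.
Local Open Scope ring_scope.

(** * Bernoulli and Young inequalities from the tangents of the exponential *)

Lemma gt0_powRE (R : realType) (x s : R) : 0 < x -> x `^ s = expR (s * ln x).
Proof. by move=> x0; rewrite /powR gt_eqF. Qed.

Lemma expR_tangent (R : realType) (m u : R) : expR m * (1 + (u - m)) <= expR u.
Proof.
have -> : expR u = expR m * expR (u - m) by rewrite -expRD addrC subrK.
by rewrite ler_wpM2l ?expR_ge0// expR_ge1Dx.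
Qed.

(** With [y = ln x], everything follows from exp z >= 1 + z: taken at [s * y] and [y] when [s <= 0],
    and at [(s - 1) * y] and [- y], multiplied by exp y, when [1 <= s]. *)
Lemma powR_bernoulli (R : realType) (s x : R) : s <= 0 \/ 1 <= s -> 0 < x ->
  s * x <= x `^ s + (s - 1).
Proof.
move=> hs x0; rewrite gt0_powRE//; set y := ln x.
have -> : x = expR y by rewrite lnK.
case: hs => hs.
- have h1 := expR_ge1Dx (s * y).
  have h2 := ler_wnM2l hs (expR_ge1Dx y).
  lra.
- have h1 := ler_wpM2l (expR_ge0 y) (expR_ge1Dx ((s - 1) * y)).
  have h2 := ler_wpM2l (expR_ge0 y) (expR_ge1Dx (- y)).
  rewrite -expRD subrr expR0 in h2.
  rewrite -expRD in h1.
  have e : y + (s - 1) * y = s * y by ring.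
  rewrite e in h1.
  have s1 : 0 <= s - 1 by lra.
  have h3 := ler_wpM2l s1 h2.
  lra.
Qed.

Lemma powR_young (R : realType) (s u v : R) : s <= 0 \/ 1 <= s ->
  0 < u -> 0 < v -> s * u * v `^ (s - 1) <= u `^ s + (s - 1) * v `^ s.
Proof.
move=> hs u0 v0.
have uv : 0 < u / v by rewrite divr_gt0.
have vs : 0 < v `^ s by rewrite powR_gt0.
have := ler_wpM2r (ltW vs) (powR_bernoulli hs uv).
rewrite mulrDl -(powRM _ (ltW uv) (ltW v0)) divfK ?gt_eqF//.
rewrite powRB ?(gt_eqF v0) ?implybT// powRr1 ?(ltW v0)//.
by apply: le_trans; rewrite le_eqVlt; apply/orP; left; apply/eqP; ring.
Qed.

(** * Weighted partial sums and the telescoping argument *)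

Lemma partial_weightS (R : realType) (f : nat -> R) n :
  partial_weight f n.+1 = partial_weight f n + f n.+1.
Proof. exact: big_ord_recr. Qed.

Lemma partial_weight0 (R : realType) (f : nat -> R) : partial_weight f 0 = f 0%N.
Proof. exact: big_ord1. Qed.

Lemma partial_weight_gt0 (R : realType) (f : nat -> R) n :
  W0 f -> 0 < partial_weight f n.
Proof.
case=> f0 fn; elim: n => [|n IH]; first by rewrite partial_weight0.
by rewrite partial_weightS ltr_wpDr.
Qed.

Lemma W0M (R : realType) (f g : nat -> R) : W0 f -> (forall n, 0 < g n) ->
  W0 (fun n => f n * g n).
Proof.
by move=> [f0 fn] g0; split=> [|n]; rewrite ?mulr_gt0// mulr_ge0// ltW.
Qed.

Lemma partial_weight_le_telescope (R : realType) (f g Z : nat -> R) :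
  f 0%N + Z 0%N <= g 0%N ->
  (forall n, f n.+1 + Z n.+1 <= g n.+1 + Z n) ->
  forall n, partial_weight f n + Z n <= partial_weight g n.
Proof.
move=> h0 hS; elim=> [|n IH]; first by rewrite !partial_weight0.
by rewrite !partial_weightS; have := hS n; lra.
Qed.

(** Common engine for power means ([F] a power, [P] positivity) and the geometric mean ([F] the
    exponential). With r = lam_n / Lam_n one has Lam_(n-1) = (1 - r) Lam_n and r a_n = A_n - (1 - r)
    A_(n-1), so the one-step inequality multiplied by Lam_n telescopes in z Lam_n F(A_n). *)
Lemma hardy_by_telescoping (R : realType) (lam a : nat -> R) (eta d z : R)
    (P : R -> Prop) (F : R -> R) :
  let A i := partial_weight (fun j => lam j * a j) i / partial_weight lam i in
  W0 lam -> (forall n, eta <= lam n / partial_weight lam n) ->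
  (forall i, P (a i)) -> (forall i, P (A i)) ->
  0 <= z -> (forall u, 0 <= F u) ->
  (forall r u v w, eta <= r -> 0 <= r -> r <= 1 -> P u -> P v -> P w ->
    r * u = v - (1 - r) * w ->
    r * F v + z * F v <= d * (r * F u) + z * ((1 - r) * F w)) ->
  forall n, partial_weight (fun i => lam i * F (A i)) n
    <= d * partial_weight (fun i => lam i * F (a i)) n.
Proof.
move=> A lamW heta Pa PA z0 F0 hstep n.
have L0 i : 0 < partial_weight lam i by exact: partial_weight_gt0.
pose Z i := z * (partial_weight lam i * F (A i)).
have Z0 i : 0 <= Z i by rewrite /Z !mulr_ge0 ?(ltW (L0 _)).
have step : partial_weight (fun i => lam i * F (A i)) n + Z n <=
    partial_weight (fun i => d * (lam i * F (a i))) n.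
  apply: (partial_weight_le_telescope (Z := Z)) => [|i].
  - have l0 : 0 < lam 0%N by case: lamW.
    have eA : A 0%N = a 0%N.
      by rewrite /A !partial_weight0 mulrAC divff ?mul1r// gt_eqF.
    have h1 : eta <= 1.
      by have := heta 0%N; rewrite partial_weight0 divff// gt_eqF.
    (* The base case is the step at [r = 1], where the preceding mean has weight 0; [A 0] merely
       fills its place. *)
    have E : 1 * a 0%N = A 0%N - (1 - 1) * A 0%N by rewrite eA; ring.
    have H := hstep _ _ _ _ h1 ler01 (lexx 1) (Pa 0%N) (PA 0%N) (PA 0%N) E.
    by have := ler_wpM2l (ltW l0) H; rewrite /Z partial_weight0; lra.
  - set L := partial_weight lam i.+1.
    have Lne : L != 0 by exact: lt0r_neq0 (L0 i.+1).
    pose r := lam i.+1 / L.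
    have lE : lam i.+1 = r * L by rewrite /r divfK.
    have L'E : partial_weight lam i = (1 - r) * L.
      by have := partial_weightS lam i; rewrite -/L mulrBl -lE mul1r; lra.
    have r0 : 0 <= r by rewrite divr_ge0 ?(ltW (L0 _))//; case: lamW.
    have r1 : r <= 1.
      by have := L0 i; rewrite L'E (pmulr_lgt0 _ (L0 i.+1 : 0 < L)); lra.
    have E : r * a i.+1 = A i.+1 - (1 - r) * A i.
      rewrite {1}/A partial_weightS -/L lE.
      have -> : partial_weight (fun j => lam j * a j) i = A i * ((1 - r) * L).
        by rewrite -L'E /A divfK// gt_eqF// L0.
      by field.
    have H := hstep _ _ _ _ (heta i.+1) r0 r1 (Pa _) (PA _) (PA _) E.
    have := ler_wpM2l (ltW (L0 i.+1)) H.
    by rewrite -/L -/r /Z -/L L'E lE; lra.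
have -> : d * partial_weight (fun i => lam i * F (a i)) n =
  partial_weight (fun i => d * (lam i * F (a i))) n by exact: mulr_sumr.
by apply: le_trans step; rewrite lerDl Z0.
Qed.

(** * Hardy inequality for power means *)

(* Sum of two Young inequalities, tight for [c * a = A] and [t * A' = A], the
   relations that hold asymptotically when the ratios tend to [eta] and
   [a_i = Lam_i `^ (- q)], with [q = 1 / s] and [t = (1 - eta) `^ q]. *)
Lemma power_hardy_step (R : realType) (s c t r a A A' : R) :
  s <= 0 \/ 1 <= s -> 0 < c -> 0 < t -> 0 <= r -> r <= 1 ->
  c * t `^ (s - 1) <= s * (c - r) - (s - 1) * (1 - r) * (c / t) ->
  0 < a -> 0 < A -> 0 < A' -> r * a = A - (1 - r) * A' ->
  r * A `^ s + c * t `^ (s - 1) * A `^ s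
    <= c `^ s * (r * a `^ s) + c * t `^ (s - 1) * ((1 - r) * A' `^ s).
Proof.
move=> hs c0 t0 r0 r1 hc a0 A0 A'0 e.
have ca : 0 < c * a by rewrite mulr_gt0.
have tA : 0 < t * A' by rewrite mulr_gt0.
have r1' : 0 <= (1 - r) * (c / t) by rewrite mulr_ge0 ?subr_ge0// ltW// divr_gt0.
(* The weights [r] and [(1 - r) * (c / t)] are chosen so that the left sides add up to
   [s * c * (r * a + (1 - r) * A') * A]^ (s - 1)[, that is]s * c * A [^ s]. *)
have := ler_wpM2l r0 (powR_young hs ca A0).
have := ler_wpM2l r1' (powR_young hs tA A0).
have := ler_wpM2r (powR_ge0 A s) hc.
rewrite (powRM _ (ltW c0) (ltW a0)) (powRM _ (ltW t0) (ltW A'0)).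
have eA : A * A `^ (s - 1) = A `^ s.
  by rewrite powRB ?(gt_eqF A0) ?implybT// powRr1 ?ltW// mulrCA divff ?mulr1// gt_eqF.
have et : t `^ s = t * t `^ (s - 1).
  by rewrite powRB ?(gt_eqF t0) ?implybT// powRr1 ?ltW// mulrCA divff ?mulr1// gt_eqF.
rewrite et.
set As := A `^ s; set A1 := A `^ (s - 1).
set ts := t `^ (s - 1) => h1 h2 h3.
have h2' : s * c * ((1 - r) * A') * A1 <=
    (1 - r) * c * ts * A' `^ s + (1 - r) * (c / t) * (s - 1) * As.
  move: h2; congr (_ <= _); rewrite /As /A1; field; exact: lt0r_neq0.
have h3' : s * c * (r * a) * A1 <= r * (c `^ s * a `^ s) + r * (s - 1) * As.
  by move: h3; congr (_ <= _); rewrite /As /A1; ring.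
have e4 : s * c * (r * a) * A1 + s * c * ((1 - r) * A') * A1 = s * c * As.
  by rewrite e /As -eA /A1; ring.
lra.
Qed.

Lemma weighted_power_hardy (R : realType) (lam a : nat -> R) (eta s c t : R) :
  W0 lam -> (forall n, 0 < a n) ->
  (forall n, eta <= lam n / partial_weight lam n) ->
  s <= 0 \/ 1 <= s -> 0 < c -> 0 < t ->
  (forall r, eta <= r -> r <= 1 ->
    c * t `^ (s - 1) <= s * (c - r) - (s - 1) * (1 - r) * (c / t)) ->
  forall n,
  partial_weight (fun i => lam i *
    (partial_weight (fun j => lam j * a j) i / partial_weight lam i) `^ s) n
  <= c `^ s * partial_weight (fun i => lam i * a i `^ s) n.
Proof.
move=> lamW a0 heta hs c0 t0 hc n.
apply: (@hardy_by_telescoping R lam a eta _ (c * t `^ (s - 1))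
  (fun u => 0 < u) (fun u => u `^ s)) => //.
- by move=> i; rewrite divr_gt0//; apply: partial_weight_gt0 => //; exact: W0M.
- by rewrite mulr_ge0 ?powR_ge0 ?ltW.
- by move=> u; exact: powR_ge0.
- by move=> r u v w hr r0 r1 u0 v0 w0; apply: power_hardy_step => //; exact: hc.
Qed.

(** The power of exponent [q^-1] of this number is the constant for the power mean of exponent [q].
    The second branch is the limit of the first as [eta] tends to 0. *)
Definition power_constant (R : realType) (eta q : R) : R :=
  if 0 < eta then eta / (1 - (1 - eta) `^ (1 - q)) else (1 - q)^-1.

Lemma powR_lt1 (R : realType) (x s : R) : 0 < x -> x < 1 -> 0 < s -> x `^ s < 1.
Proof.
move=> x0 x1 s0; rewrite gt0_powRE// expR_lt1 pmulr_rlt0// ln_lt0// x0 x1 //.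
Qed.

Lemma power_constant_gt0 (R : realType) (eta q : R) : eta < 1 -> q < 1 ->
  0 < power_constant eta q.
Proof.
move=> eta1 q1; rewrite /power_constant; case: ifPn => eta0.
- by rewrite divr_gt0// subr_gt0 powR_lt1// ?subr_gt0//; lra.
- by rewrite invr_gt0 subr_gt0.
Qed.

(** Right minus left is affine in [r] and vanishes at [r = eta]. For [eta > 0] its slope is
    nonnegative by Bernoulli at t = (1 - eta)^q with exponent 1/q, since t^(1/q) = 1 - eta; for
    [eta = 0] both sides agree. *)
Lemma power_constant_ineq (R : realType) (eta q r : R) :
  0 <= eta -> eta < 1 -> q < 1 -> q != 0 -> eta <= r ->
  power_constant eta q * ((1 - eta) `^ q) `^ (q^-1 - 1) <=
  q^-1 * (power_constant eta q - r)
  - (q^-1 - 1) * (1 - r) * (power_constant eta q / (1 - eta) `^ q).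
Proof.
move=> eta0 eta1 q1 q0 hr.
set s := q^-1; set c := power_constant eta q; set t := (1 - eta) `^ q.
have e0 : 0 < 1 - eta by lra.
have t0 : 0 < t by exact: powR_gt0.
have ets : t `^ s = 1 - eta by rewrite -powRrM divff// powRr1// ltW.
have hs : s <= 0 \/ 1 <= s.
  case: (ltrP q 0) => hq; first by left; rewrite ltW// invr_lt0.
  by right; rewrite invf_ge1 ?(ltW q1)// lt_def q0.
rewrite (_ : t `^ (s - 1) = (1 - eta) `^ (1 - q)); last first.
  by rewrite -powRrM mulrBr mulr1 divff.
rewrite /c /power_constant; case: ifPn => [eta_gt0|]; last first.
- rewrite -leNgt => eta_le0; have {}eta0 : eta = 0 by lra.
  rewrite /t eta0 subr0 !powR1 /s le_eqVlt; apply/orP; left; apply/eqP.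
  field; rewrite q0 /=; lra.
- set w := (1 - eta) `^ (1 - q).
  have w1 : w < 1 by apply: powR_lt1; lra.
  have ew : w * t = 1 - eta.
    by rewrite /w /t -powRD ?subrK ?(gt_eqF e0) ?implybT// powRr1// ltW.
  have := powR_bernoulli hs t0; rewrite ets => hb.
  have w1' : 0 < 1 - w by lra.
  rewrite -subr_ge0.
  (* The second summand vanishes by [ew]; it is kept to make this an identity of rational functions
     in independent [t] and [w]. *)
  rewrite (_ : _ - _ = ((r - eta) * (s - s * t - eta)
    + (s * r - eta) * (w * t - (1 - eta))) / (t * (1 - w))); last first.
    by field; rewrite !gt_eqF.
  rewrite ew subrr mulr0 addr0.
  by rewrite divr_ge0 ?mulr_ge0 ?(ltW w1') ?(ltW t0)//; lra.
Qed.

Lemma power_mean_hardy (R : realType) (lam x : nat -> R) (eta q : R) :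
  W0 lam -> (forall n, 0 < x n) ->
  (forall n, eta <= lam n / partial_weight lam n) ->
  0 <= eta -> eta < 1 -> q < 1 -> q != 0 ->
  forall n,
  partial_weight (fun i => lam i *
    (partial_weight (fun j => lam j * x j `^ q) i / partial_weight lam i) `^ q^-1) n
  <= power_constant eta q `^ q^-1 * partial_weight (fun i => lam i * x i) n.
Proof.
move=> lamW x0 heta eta0 eta1 q1 q0 n.
have xq i : 0 < x i `^ q by exact: powR_gt0.
have hs : q^-1 <= 0 \/ 1 <= q^-1.
  case: (ltrP q 0) => hq; first by left; rewrite ltW// invr_lt0.
  by right; rewrite invf_ge1 ?(ltW q1)// lt_def q0.
have := weighted_power_hardy lamW xq heta hs (power_constant_gt0 eta1 q1)
  (powR_gt0 q (_ : 0 < 1 - eta))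
  (fun r hr _ => power_constant_ineq eta0 eta1 q1 q0 hr) n.
rewrite subr_gt0 => /(_ eta1).
have -> // : (fun i => lam i * x i `^ q `^ q^-1) = (fun i => lam i * x i).
by apply/funext => i; rewrite -powRrM divff// powRr1// ltW.
Qed.

(** * Hardy inequality for the geometric mean *)

(** The logarithm of the constant for [p = q = 0]; the value 1 is the limit of the first branch as
    [eta] tends to 0. *)
Definition carleman_constant (R : realType) (eta : R) : R :=
  if 0 < eta then ln (1 - eta) * (1 - eta^-1) else 1.

(** Exponential counterpart of [power_hardy_step]: the tangent at [A] is evaluated at [k + a] and
    [tau + A'] with weights [r] and [1 - r], and the linear parts combine through the recursion of
    the means. *)
Lemma geometric_hardy_step (R : realType) (k tau r a A A' : R) :
  0 <= r -> r <= 1 -> expR tau <= (1 - r) * (1 + tau) + r * k ->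
  r * a = A - (1 - r) * A' ->
  r * expR A + expR tau * expR A
    <= expR k * (r * expR a) + expR tau * ((1 - r) * expR A').
Proof.
move=> r0 r1 hc e.
have r1' : 0 <= 1 - r by lra.
have := ler_wpM2l r0 (expR_tangent A (k + a)).
have := ler_wpM2l r1' (expR_tangent A (tau + A')).
have := ler_wpM2l (expR_ge0 A) hc.
rewrite !expRD => h1 h2 h3.
have e2 : r * (expR A * (1 + (k + a - A))) +
   (1 - r) * (expR A * (1 + (tau + A' - A))) =
   expR A * (1 + r * k + (1 - r) * tau + (r * a + (1 - r) * A' - A)) by ring.
rewrite e in e2; lra.
Qed.

(** For [eta > 0], right minus left is [(r - eta) * (- eta - l) / eta] with
    [l = ln (1 - eta) <= - eta]. *)
Lemma carleman_constant_ineq (R : realType) (eta r : R) :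
  0 <= eta -> eta < 1 -> eta <= r ->
  expR (ln (1 - eta)) <=
    (1 - r) * (1 + ln (1 - eta)) + r * carleman_constant eta.
Proof.
move=> eta0 eta1 hr.
have e0 : 0 < 1 - eta by lra.
rewrite lnK//; set l := ln _.
have : l <= - eta by apply: le_ln1Dx; lra.
rewrite /carleman_constant; case: ifPn => [eta_gt0|]; last first.
- rewrite -leNgt => eta_le0; have {}eta0 : eta = 0 by lra.
  by rewrite /l eta0 subr0 ln1; lra.
- move=> hl; rewrite -/l -subr_ge0.
  rewrite (_ : _ - _ = (r - eta) * (- eta - l) / eta); last by field; rewrite gt_eqF.
  by rewrite divr_ge0 ?mulr_ge0//; lra.
Qed.

Lemma geometric_mean_hardy (R : realType) (lam x : nat -> R) (eta : R) :
  W0 lam -> (forall n, 0 < x n) ->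
  (forall n, eta <= lam n / partial_weight lam n) ->
  0 <= eta -> eta < 1 ->
  forall n,
  partial_weight (fun i => lam i *
    expR (partial_weight (fun j => lam j * ln (x j)) i / partial_weight lam i)) n
  <= expR (carleman_constant eta) * partial_weight (fun i => lam i * x i) n.
Proof.
move=> lamW x0 heta eta0 eta1 n.
have := @hardy_by_telescoping R lam (fun i => ln (x i)) eta
  (expR (carleman_constant eta)) (expR (ln (1 - eta))) (fun=> True) (@expR R)
  lamW heta (fun=> I) (fun=> I) (expR_ge0 _) (@expR_ge0 R).
have -> : (fun i => lam i * expR (ln (x i))) = (fun i => lam i * x i).
  by apply/funext => i; rewrite lnK// posrE.
apply=> r u v w hr r0 r1 _ _ _; apply: geometric_hardy_step => //.
exact: carleman_constant_ineq.
Qed.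

(** * From power means to the Gini mean: the upper bound *)

Lemma expR_convex (R : realType) (th a b : R) : 0 <= th -> 0 <= 1 - th ->
  expR (th * a + (1 - th) * b) <= th * expR a + (1 - th) * expR b.
Proof.
move=> th0 th1; set m := th * a + (1 - th) * b.
apply: le_trans (lerD (ler_wpM2l th0 (expR_tangent m a))
  (ler_wpM2l th1 (expR_tangent m b))).
by rewrite le_eqVlt; apply/orP; left; apply/eqP; rewrite /m; ring.
Qed.

Lemma power_constant0 (R : realType) (eta : R) : 0 <= eta -> eta < 1 ->
  power_constant eta 0 = 1.
Proof.
move=> eta0 eta1; rewrite /power_constant subr0 invr1 powRr1 ?subr_ge0 ?ltW//.
case: ifPn => // e0; rewrite opprB addrC subrK divff// gt_eqF//.
Qed.

(** Weighted AM-GM: the left side is the geometric mean of [U]^ q^-1[and]V [^ p^-1] with the weights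
    on the right. If [q = 0], the first weight is 0 and [U = 1] makes the factor disappear on the
    left as well; likewise for [p = 0]. *)
Lemma powR_ratio_le (R : realType) (p q U V : R) : p != q ->
  0 <= q / (q - p) -> 0 <= p / (p - q) -> 0 < U -> 0 < V ->
  (p = 0 -> V = 1) -> (q = 0 -> U = 1) ->
  (V / U) `^ (p - q)^-1
    <= q / (q - p) * U `^ q^-1 + p / (p - q) * V `^ p^-1.
Proof.
move=> pq hq hp U0 V0 p0 q0.
have pq0 : p - q != 0 by rewrite subr_eq0.
have qp0 : q - p != 0 by rewrite subr_eq0 eq_sym.
have e : 1 - q / (q - p) = p / (p - q) by field; rewrite ?pq0 ?qp0.
rewrite !gt0_powRE ?divr_gt0// ln_div ?posrE//.
have := @expR_convex R (q / (q - p)) (q^-1 * ln U) (p^-1 * ln V) hq.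
rewrite e => /(_ hp); apply: le_trans; rewrite ler_expR le_eqVlt; apply/orP; left.
have -> : q / (q - p) * (q^-1 * ln U) = ln U / (q - p).
  have [/[dup]/q0-> ->|nz] := eqVneq q 0; first by rewrite ln1 !mul0r.
  by field; rewrite ?nz ?pq0 ?qp0.
have -> : p / (p - q) * (p^-1 * ln V) = ln V / (p - q).
  have [/[dup]/p0-> ->|nz] := eqVneq p 0; first by rewrite ln1 !mul0r.
  by field; rewrite ?nz ?pq0 ?qp0.
by apply/eqP; field; rewrite ?pq0 ?qp0.
Qed.

Lemma partial_weightM (R : realType) (c : R) (f : nat -> R) n :
  partial_weight (fun i => c * f i) n = c * partial_weight f n.
Proof. by rewrite /partial_weight mulr_sumr. Qed.

Lemma partial_weightD (R : realType) (f g : nat -> R) n :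
  partial_weight (fun i => f i + g i) n = partial_weight f n + partial_weight g n.
Proof. exact: big_split. Qed.

Lemma ler_partial_weight (R : realType) (f g : nat -> R) n :
  (forall i, f i <= g i) -> partial_weight f n <= partial_weight g n.
Proof. by move=> fg; apply: ler_sum. Qed.

Lemma gini_meanE (R : realType) (p q : R) (lam x : nat -> R) n : p != q ->
  gini_mean p q (fun i : 'I_n.+1 => x i) (fun i => lam i) =
  (partial_weight (fun i => lam i * x i `^ p) n /
   partial_weight (fun i => lam i * x i `^ q) n) `^ (p - q)^-1.
Proof. by rewrite /gini_mean => /negbTE ->. Qed.

Lemma gini_mean00E (R : realType) (lam x : nat -> R) n :
  gini_mean 0 0 (fun i : 'I_n.+1 => x i) (fun i => lam i) =
  expR (partial_weight (fun i => lam i * ln (x i)) n / partial_weight lam n).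
Proof.
rewrite /gini_mean eqxx /partial_weight.
under eq_bigr do rewrite powRr0 mulr1.
by under [X in _ / X]eq_bigr do rewrite powRr0 mulr1.
Qed.

Lemma gini_mean_ge0 (R : realType) (p q : R) n (x lam : 'I_n -> R) :
  0 <= gini_mean p q x lam.
Proof. by rewrite /gini_mean; case: ifP; rewrite ?expR_ge0 ?powR_ge0. Qed.

(** A form without case split on [eta], in which both bounds produce the constant; [gini_constantE]
    unfolds it. *)
Definition gini_constant (R : realType) (eta p q : R) : R :=
  if p != q then
    (power_constant eta p / power_constant eta q) `^ (p - q)^-1
  else expR (carleman_constant eta).

Lemma gini_constantE (R : realType) (eta p q : R) :
  0 <= eta -> eta < 1 -> p < 1 -> q < 1 ->
  gini_constant eta p q =
    (if p != q then
       if 0 < eta then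
         ((1 - (1 - eta) `^ (1 - q)) / (1 - (1 - eta) `^ (1 - p)))
           `^ (p - q)^-1
       else ((1 - q) / (1 - p)) `^ (p - q)^-1
     else
       if 0 < eta then (1 - eta) `^ (1 - eta^-1)
       else expR 1).
Proof.
move=> eta0 eta1 p1 q1; rewrite /gini_constant /power_constant /carleman_constant.
have e1 : 0 < 1 - eta by lra.
case: ifPn => pq; case: ifPn => // eta_gt0.
- have e2 : 1 - eta < 1 by lra.
  have hp : 1 - (1 - eta) `^ (1 - p) != 0.
    by rewrite gt_eqF// subr_gt0 powR_lt1// subr_gt0.
  have hq : 1 - (1 - eta) `^ (1 - q) != 0.
    by rewrite gt_eqF// subr_gt0 powR_lt1// subr_gt0.
  by congr (_ `^ _); field; rewrite hp hq gt_eqF.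
- have hp : 1 - p != 0 by rewrite gt_eqF// subr_gt0.
  have hq : 1 - q != 0 by rewrite gt_eqF// subr_gt0.
  by congr (_ `^ _); field; rewrite hp hq.
- by rewrite gt0_powRE// mulrC.
Qed.

Lemma gini_constant_ge0 (R : realType) (eta p q : R) : 0 <= gini_constant eta p q.
Proof. by rewrite /gini_constant; case: ifP; rewrite ?expR_ge0 ?powR_ge0. Qed.

Lemma gini_hardy_partial (R : realType) (lam x : nat -> R) (eta p q : R) :
  W0 lam -> (forall n, 0 < x n) ->
  (forall n, eta <= lam n / partial_weight lam n) ->
  0 <= eta -> eta < 1 -> Num.min p q <= 0 -> 0 <= Num.max p q -> Num.max p q < 1 ->
  forall n,
  partial_weight (fun k => lam k *
      gini_mean p q (fun i : 'I_k.+1 => x i) (fun i => lam i)) n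
  <= gini_constant eta p q * partial_weight (fun i => lam i * x i) n.
Proof.
move=> lamW x0 heta eta0 eta1 hmin hmax; rewrite gt_max => /andP[p1 q1] n.
rewrite /gini_constant; case: ifPn => [pq|]; last first.
  rewrite negbK => /eqP pq; subst q; rewrite minxx in hmin; rewrite maxxx in hmax.
  have -> : p = 0 by lra.
  have := geometric_mean_hardy lamW x0 heta eta0 eta1 n; apply: le_trans.
  by apply: ler_partial_weight => i; rewrite gini_mean00E.
(* 0 lies between [p] and [q], so both AM-GM weights are nonnegative. *)
have [hq hp] : 0 <= q / (q - p) /\ 0 <= p / (p - q).
  move: hmin hmax pq; rewrite /Num.min /Num.max; case: ltgtP => // pq hmin hmax _.
  - split; first by rewrite divr_ge0//; lra.
    by rewrite -mulrNN -invrN divr_ge0//; lra.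
  - split; last by rewrite divr_ge0//; lra.
    by rewrite -mulrNN -invrN divr_ge0//; lra.
set Kp := power_constant eta p; set Kq := power_constant eta q.
have Kp0 : 0 < Kp by exact: power_constant_gt0.
have Kq0 : 0 < Kq by exact: power_constant_gt0.
pose S r i := partial_weight (fun j => lam j * x j `^ r) i.
have S0 r i : 0 < S r i.
  by apply/partial_weight_gt0/W0M => // j; exact: powR_gt0.
have L0 i : 0 < partial_weight lam i by exact: partial_weight_gt0.
pose m r i := (S r i / partial_weight lam i / power_constant eta r) `^ r^-1.
have S00 i : S 0 i = partial_weight lam i.
  by apply: eq_bigr => j _; rewrite powRr0 mulr1.
have hm r : r < 1 -> r != 0 ->
    partial_weight (fun i => lam i * m r i) n
    <= partial_weight (fun i => lam i * x i) n.
  move=> r1 r0; have K0 := power_constant_gt0 eta1 r1.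
  have := power_mean_hardy lamW x0 heta eta0 eta1 r1 r0 n.
  rewrite -ler_pdivrMl ?powR_gt0// -partial_weightM; apply: le_trans.
  apply: ler_partial_weight => i; rewrite /m -/(S r i).
  rewrite (powRM _ (ltW (divr_gt0 (S0 r i) (L0 i))))// ?invr_ge0 ?(ltW K0)//.
  rewrite (_ : (power_constant eta r)^-1 `^ r^-1 = (power_constant eta r `^ r^-1)^-1).
    by rewrite mulrA mulrC.
  by rewrite !gt0_powRE ?invr_gt0// lnV ?posrE// mulrN expRN.
(* An exponent 0, excluded from [hm], enters only with weight 0. *)
have hmth r th : r < 1 -> (r = 0 -> th = 0) -> 0 <= th ->
    th * partial_weight (fun i => lam i * m r i) n
    <= th * partial_weight (fun i => lam i * x i) n.
  move=> r1 r0 th0; have [/r0->|rn0] := eqVneq r 0; first by rewrite !mul0r.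
  by rewrite ler_wpM2l// hm.
apply: (@le_trans _ _ (partial_weight (fun i => (Kp / Kq) `^ (p - q)^-1 *
    (q / (q - p) * (lam i * m q i) + p / (p - q) * (lam i * m p i))) n)).
  apply: ler_partial_weight => i; rewrite gini_meanE// -/(S p i) -/(S q i).
  pose U := S q i / partial_weight lam i / Kq.
  pose V := S p i / partial_weight lam i / Kp.
  have U0 : 0 < U by rewrite !divr_gt0.
  have V0 : 0 < V by rewrite !divr_gt0.
  have -> : S p i / S q i = Kp / Kq * (V / U).
    by rewrite /U /V; field; rewrite !gt_eqF.
  rewrite powRM ?(ltW (divr_gt0 _ _))//.
  have := powR_ratio_le pq hq hp U0 V0.
  have V1 : p = 0 -> V = 1.
    by move=> p0; rewrite /V /Kp p0 power_constant0// S00 divff ?divr1// gt_eqF.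
  have U1 : q = 0 -> U = 1.
    by move=> p0; rewrite /U /Kq p0 power_constant0// S00 divff ?divr1// gt_eqF.
  move=> /(_ V1 U1) h.
  have l0 : 0 <= lam i by case: lamW.
  have := ler_wpM2l (mulr_ge0 l0 (powR_ge0 (Kp / Kq) (p - q)^-1)) h.
  by rewrite -/(m q i) -/(m p i); lra.
rewrite partial_weightM ler_wpM2l ?powR_ge0// partial_weightD !partial_weightM.
have h1 := hmth q (q / (q - p)) q1 _ hq.
have h2 := hmth p (p / (p - q)) p1 _ hp.
have e : 1 - q / (q - p) = p / (p - q).
  by field; rewrite !subr_eq0 pq eq_sym pq.
apply: le_trans (lerD (h1 _) (h2 _)) _.
- by move=> ->; rewrite mul0r.
- by move=> ->; rewrite mul0r.
- by rewrite -e -mulrDl addrC subrK mul1r.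
Qed.

Lemma nneseries_le_of_partial (R : realType) (f g : nat -> R) (c : R) :
  0 <= c -> (forall n, 0 <= f n) -> (forall n, 0 <= g n) ->
  (forall n, partial_weight f n <= c * partial_weight g n) ->
  (\sum_(0 <= n <oo) (f n)%:E <= c%:E * \sum_(0 <= n <oo) (g n)%:E)%E.
Proof.
move=> c0 f0 g0 fg; apply: lime_le.
  by apply: is_cvg_nneseries => n _ _; rewrite lee_fin.
apply: nearW => -[|n].
  rewrite big_nil mule_ge0 ?lee_fin//.
  by apply: nneseries_ge0 => n _ _; rewrite lee_fin.
apply: (@le_trans _ _ (c%:E * \sum_(0 <= k < n.+1) (g k)%:E)%E).
  by rewrite !sumEFin -EFinM lee_fin !big_mkord; exact: fg.
rewrite lee_wpmul2l ?lee_fin//.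
by apply: nneseries_lim_ge => k _ _; rewrite lee_fin.
Qed.

Lemma gini_constant_hardy_bound (R : realType) (lam : nat -> R) (eta p q : R) :
  W0 lam -> (forall n, eta <= lam n / partial_weight lam n) ->
  0 <= eta -> eta < 1 -> Num.min p q <= 0 -> 0 <= Num.max p q -> Num.max p q < 1 ->
  hardy_bounds (gini_mean p q) lam (gini_constant eta p q)%:E.
Proof.
move=> lamW heta eta0 eta1 hmin hmax hmax1 x x0.
have l0 i : 0 <= lam i by case: lamW.
apply: nneseries_le_of_partial.
- exact: gini_constant_ge0.
- by move=> n; rewrite mulr_ge0 ?gini_mean_ge0.
- by move=> n; rewrite mulr_ge0// ltW.
- exact: gini_hardy_partial.
Qed.

(** * The Stolz-Cesaro theorem and limits of the elementary functions involved *)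

Lemma stolz_cesaro (R : realType) (u v : nat -> R) (l : R) :
  (forall n, v n < v n.+1) -> v n @[n --> \oo] --> +oo ->
  ((u n.+1 - u n) / (v n.+1 - v n)) @[n --> \oo] --> l ->
  (u n / v n) @[n --> \oo] --> l.
Proof.
move=> vlt /cvgryPge voo /cvgrPdist_le hd; apply/cvgrPdist_le => e e0.
have e2 : 0 < e / 2 by rewrite divr_gt0.
have [n0 _ hn0] := hd _ e2.
pose K := `|l * v n0 - u n0|.
have step k : `|l * v (n0 + k)%N - u (n0 + k)%N| <= e / 2 * (v (n0 + k)%N - v n0) + K.
  elim: k => [|k IH]; first by rewrite addn0 subrr mulr0 add0r.
  have := hn0 (n0 + k)%N (leq_addr _ _); rewrite addnS /=.
  set m := (n0 + k)%N in IH *; have dv : 0 < v m.+1 - v m by rewrite subr_gt0.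
  rewrite -[X in `|X|](mulfK (lt0r_neq0 dv)) normrM normfV (gtr0_norm dv).
  rewrite ler_pdivrMr// mulrBl divfK ?lt0r_neq0// => h.
  have -> : l * v m.+1 - u m.+1 =
    (l * (v m.+1 - v m) - (u m.+1 - u m)) + (l * v m - u m) by ring.
  by apply: le_trans (ler_normD _ _) _; lra.
(* This threshold makes [v n] positive and absorbs the constant [K - e / 2 * v n0] into a second
   [e / 2 * v n]. *)
have [n1 _ hn1] := voo (Num.max 1 ((K - e / 2 * v n0) / (e / 2))).
exists (maxn n0 n1) => // n /=; rewrite geq_max => /andP[h0 h1].
have := hn1 _ h1; rewrite ge_max => /andP[v1]; rewrite ler_pdivrMr// => hv.
have vn : 0 < v n by apply: lt_le_trans v1.
have := step (n - n0)%N; rewrite subnKC// => h.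
rewrite -[X in `|X|](mulfK (lt0r_neq0 vn)) normrM normfV (gtr0_norm vn).
rewrite ler_pdivrMr// mulrBl divfK ?lt0r_neq0//.
apply: le_trans h _; lra.
Qed.

Lemma eq_cvgn (R : realType) (u v : nat -> R) (l : R) : u =1 v ->
  u n @[n --> \oo] --> l -> v n @[n --> \oo] --> l.
Proof. by move=> /funext ->. Qed.

Lemma cvg_powR (R : realType) (u : nat -> R) (l a : R) : 0 < l ->
  u n @[n --> \oo] --> l -> (u n `^ a) @[n --> \oo] --> l `^ a.
Proof.
move=> l0 ul; apply: (@continuous_cvg _ _ _ _ _ u (fun x : R => x `^ a) l) ul.
apply/differentiable_continuous/derivable1_diffP/derivable_powR.
by rewrite in_itv/= l0.
Qed.

Lemma cvg_expR (R : realType) (u : nat -> R) (l : R) :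
  u n @[n --> \oo] --> l -> expR (u n) @[n --> \oo] --> expR l.
Proof. by move=> ul; apply: continuous_cvg ul; exact: continuous_expR. Qed.

Lemma cvg_ln (R : realType) (u : nat -> R) (l : R) : 0 < l ->
  u n @[n --> \oo] --> l -> ln (u n) @[n --> \oo] --> ln l.
Proof. by move=> l0 ul; apply: continuous_cvg ul; exact: continuous_ln. Qed.

Lemma cvgry_powR (R : realType) (u : nat -> R) (a : R) : 0 < a ->
  u n @[n --> \oo] --> +oo -> (u n `^ a) @[n --> \oo] --> +oo.
Proof.
move=> a0 /cvgryPge uoo; apply/cvgryPge => A.
have [N _ hN] := uoo (Num.max 1 A `^ a^-1); exists N => // n /= hn.
have m0 : 0 <= Num.max 1 A by rewrite le_max ler01.
apply: (@le_trans _ _ (Num.max 1 A)); first by rewrite le_max lexx orbT.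
have -> : Num.max 1 A = (Num.max 1 A `^ a^-1) `^ a.
  by rewrite -powRrM mulVf ?lt0r_neq0// powRr1.
have h := hN n hn.
apply: (ge0_ler_powR (ltW a0) _ _ h); rewrite nnegrE ?powR_ge0//.
exact: le_trans (powR_ge0 _ _) h.
Qed.

Lemma cvgry_ln (R : realType) (u : nat -> R) :
  u n @[n --> \oo] --> +oo -> ln (u n) @[n --> \oo] --> +oo.
Proof.
move=> /cvgryPge uoo; apply/cvgryPge => A.
have [N _ hN] := uoo (expR A); exists N => // n /= hn.
have h := hN n hn; rewrite -[leLHS]expRK ler_ln// posrE ?expR_gt0//.
exact: lt_le_trans (expR_gt0 A) h.
Qed.

(** For [eta > 0] this is continuity. For [eta = 0] the quotient is of type 0/0: with w = - ln (1 -
    r) and a = 1 - q it equals (1 - exp(-w)) / (1 - exp(-a w)), and z exp(-z) <= 1 - exp(-z) <= z at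
    z = w and z = a w encloses it between exp(-w) / a and exp(a w) / a. *)
Lemma cvg_power_constant (R : realType) (r : nat -> R) (eta q : R) :
  (forall n, 0 < r n) -> (forall n, r n < 1) -> 0 <= eta -> eta < 1 -> q < 1 ->
  r n @[n --> \oo] --> eta ->
  (r n / (1 - (1 - r n) `^ (1 - q))) @[n --> \oo] --> power_constant eta q.
Proof.
move=> r0 r1 eta0 eta1 q1 rcv; rewrite /power_constant.
have a0 : 0 < 1 - q by lra.
have e0 : 0 < 1 - eta by lra.
have cv1 : (1 - r n) @[n --> \oo] --> 1 - eta by apply: cvgB => //; exact: cvg_cst.
case: ifPn => [eta_gt0|].
  apply: cvgM => //; apply: cvgV.
    by rewrite gt_eqF// subr_gt0 powR_lt1//; lra.
  by apply: cvgB; [exact: cvg_cst|exact: cvg_powR].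
rewrite -leNgt => eta_le0; have eta_eq0 : eta = 0 by lra.
rewrite eta_eq0 subr0 in cv1.
set a := 1 - q in a0 *.
apply: (@squeeze_cvgr _ _ _ _ (fun n => (1 - r n) / a)
  (fun n => (1 - r n) `^ (- a) / a)).
- apply: nearW => n; set w := - ln (1 - r n).
  have h0 : 0 < 1 - r n by rewrite subr_gt0.
  have w0 : 0 < w by rewrite oppr_gt0 ln_lt0// h0 gtrBl r0.
  have Er : 1 - r n = expR (- w) by rewrite opprK lnK.
  rewrite !gt0_powRE// -[ln _]opprK -/w Er.
  have -> : r n = 1 - expR (- w) by rewrite -Er; ring.
  have -> : - a * - w = a * w by ring.
  have -> : a * - w = - (a * w) by ring.
  have aw : 0 < a * w by rewrite mulr_gt0.
  have lo (z : R) : z * expR (- z) <= 1 - expR (- z).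
    have := expR_tangent (- z) 0; rewrite expR0; lra.
  have hi (z : R) : 1 - expR (- z) <= z by have := expR_ge1Dx (- z); lra.
  have d0 : 0 < 1 - expR (- (a * w)) by rewrite subr_gt0 expR_lt1; lra.
  apply/andP; split.
    rewrite ler_pdivlMr// mulrAC ler_pdivrMr//.
    have := ler_wpM2l (expR_ge0 (- w)) (hi (a * w)).
    have := ler_wpM2r (ltW a0) (lo w); lra.
  rewrite ler_pdivrMr// mulrAC ler_pdivlMr//.
  have h1 := ler_wpM2r (ltW a0) (hi w).
  have h2 := ler_wpM2l (expR_ge0 (a * w)) (lo (a * w)).
  apply: le_trans h1 _; apply: le_trans h2.
  by rewrite mulrCA -expRD subrr expR0 mulr1 mulrC.
- rewrite -[X in _ --> X]mul1r; apply: cvgM => //; exact: cvg_cst.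
- have h := cvgM (cvg_powR (a := - a) ltr01 cv1) (cvg_cst a^-1).
  by rewrite powR1 mul1r in h; exact: h.
Qed.

Lemma cvg_carleman_constant (R : realType) (r : nat -> R) (eta : R) :
  (forall n, 0 < r n) -> (forall n, r n < 1) -> 0 <= eta -> eta < 1 ->
  r n @[n --> \oo] --> eta ->
  (ln (1 - r n) * (1 - (r n)^-1)) @[n --> \oo] --> carleman_constant eta.
Proof.
move=> r0 r1 eta0 eta1 rcv; rewrite /carleman_constant.
have e0 : 0 < 1 - eta by lra.
have cv1 : (1 - r n) @[n --> \oo] --> 1 - eta by apply: cvgB => //; exact: cvg_cst.
case: ifPn => [eta_gt0|].
  apply: cvgM; first exact: cvg_ln.
  by apply: cvgB; [exact: cvg_cst|apply: cvgV => //; rewrite gt_eqF].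
rewrite -leNgt => eta_le0; have eta_eq0 : eta = 0 by lra.
rewrite eta_eq0 subr0 in cv1.
(* With w = - ln (1 - r) the term is w (1 - r) / r, and (1 - r) w <= r <= w. *)
apply: (@squeeze_cvgr _ _ _ _ (fun n => 1 - r n) (fun=> 1)) => //; last exact: cvg_cst.
apply: nearW => n; set w := - ln (1 - r n).
have h0 : 0 < 1 - r n by rewrite subr_gt0.
have Er : 1 - r n = expR (- w) by rewrite opprK lnK.
have -> : ln (1 - r n) * (1 - (r n)^-1) = w * (1 - r n) / r n.
  by rewrite /w; field; rewrite gt_eqF.
rewrite ler_pdivlMr// ler_pdivrMr// mul1r mulrC ler_pM2r//.
have h1 := expR_ge1Dx (- w).
have h2 := expR_tangent (- w) 0; rewrite expR0 in h2.
by rewrite -Er in h1 h2; apply/andP; split; lra.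
Qed.

(** * Real consequences of an extended-real Hardy bound *)

Lemma hardy_bounds_partial (R : realType)
    (M : forall n : nat, ('I_n -> R) -> ('I_n -> R) -> R)
    (lam x : nat -> R) (c b : R) :
  (forall n (y l : 'I_n -> R), 0 <= M n y l) -> W0 lam -> (forall n, 0 < x n) ->
  hardy_bounds M lam c%:E ->
  (forall n, partial_weight (fun i => lam i * x i) n <= b) ->
  forall n, partial_weight (fun k => lam k *
      M k.+1 (fun i => x i) (fun i => lam i)) n <= c * b.
Proof.
move=> M0 lamW x0 /(_ x x0) hb hx n.
have l0 i : 0 <= lam i by case: lamW.
set X := (\sum_(0 <= n <oo) (lam n * x n)%:E)%E in hb.
have Xb : (X <= b%:E)%E.
  apply: lime_le.
    by apply: is_cvg_nneseries => k _ _; rewrite lee_fin mulr_ge0// ltW.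
  exists 1%N => // -[//|k] _ /=.
  by rewrite sumEFin lee_fin big_mkord; exact: hx.
have X0 : ((lam 0%N * x 0%N)%:E <= X)%E.
  have := @nneseries_lim_ge R (fun n => (lam n * x n)%:E) xpredT 0%N 1%N.
  rewrite big_nat1; apply => k _ _; rewrite lee_fin mulr_ge0// ltW//.
have Xfin : X \is a fin_num.
  rewrite fin_numE; apply/andP; split.
    by apply/eqP => XE; rewrite XE in X0.
  by apply/eqP => XE; rewrite XE in Xb.
rewrite -(fineK Xfin) in hb Xb X0; set y := fine X in hb Xb X0.
rewrite !lee_fin in Xb X0.
have y0 : 0 < y.
  by apply: lt_le_trans X0; rewrite mulr_gt0//; case: lamW.
set W := partial_weight _ n.
have W_ge0 : 0 <= W by apply: sumr_ge0 => i _; rewrite mulr_ge0.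
have hW : W <= c * y.
  rewrite -lee_fin EFinM; apply: le_trans hb.
  rewrite /W /partial_weight -(big_mkord xpredT
    (fun k => lam k * M k.+1 (fun i => x i) (fun i => lam i))) -sumEFin.
  by apply: nneseries_lim_ge => k _ _; rewrite lee_fin mulr_ge0.
(* The sign of [c], needed to replace the sum [y] by its bound [b], comes from 0 <= W <= c y with y
   > 0. *)
have c0 : 0 <= c by rewrite -(pmulr_lge0 _ y0); exact: le_trans hW.
by apply: le_trans hW _; rewrite ler_wpM2l.
Qed.

(** For the constant sequence 1 the right-hand series is positive, so its product with -oo is -oo,
    while the left side is nonnegative. *)
Lemma hardy_bounds_gtNy (R : realType)
    (M : forall n : nat, ('I_n -> R) -> ('I_n -> R) -> R) (lam : nat -> R) :
  (forall n (y l : 'I_n -> R), 0 <= M n y l) -> W0 lam ->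
  ~ hardy_bounds M lam -oo%E.
Proof.
move=> M0 lamW /(_ (fun=> 1) (fun=> ltr01)).
have l0 i : 0 <= lam i by case: lamW.
rewrite gt0_mulNye => [|]; last first.
  apply: (@lt_le_trans _ _ ((lam 0%N * 1)%:E)).
    by rewrite lte_fin mulr1; case: lamW.
  have := @nneseries_lim_ge R (fun n => (lam n * 1)%:E) xpredT 0%N 1%N.
  by rewrite big_nat1; apply => k _ _; rewrite lee_fin mulr1.
apply/negP; rewrite -ltNge; apply: (@lt_le_trans _ _ 0%E); first exact: ltNy0.
by apply: nneseries_ge0 => k _ _; rewrite lee_fin mulr_ge0.
Qed.

(** * Positivity of the weights and divergence of the sum of the ratios *)

(** A zero weight would force all later ratios, hence all later weights, to vanish, and the partial
    weights would stay bounded. *)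
Lemma weight_gt0 (R : realType) (lam : nat -> R) :
  W0 lam -> partial_weight lam n @[n --> \oo] --> +oo ->
  nonincreasing_seq (fun n => lam n / partial_weight lam n) ->
  forall n, 0 < lam n.
Proof.
move=> lamW /cvgryPgt Loo mono n; have [l0 ln] := lamW.
rewrite lt_def ln andbT; apply/eqP => lamn.
have L0 i : 0 < partial_weight lam i by exact: partial_weight_gt0.
have vanish m : (n <= m)%N -> lam m = 0.
  move=> nm; apply/eqP; rewrite eq_le ln andbT.
  by have := mono _ _ nm; rewrite lamn mul0r ler_pdivrMr// mul0r.
have const m : partial_weight lam (n + m)%N = partial_weight lam n.
  elim: m => [|m IH]; first by rewrite addn0.
  by rewrite addnS partial_weightS vanish ?addr0// -addnS leq_addr.
have [N _ /(_ (n + N)%N (leq_addl _ _))] := Loo (partial_weight lam n).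
by rewrite /= const ltxx.
Qed.

Lemma ratioSE (R : realType) (lam : nat -> R) n : W0 lam ->
  1 - lam n.+1 / partial_weight lam n.+1 =
  partial_weight lam n / partial_weight lam n.+1.
Proof.
move=> lamW; have := partial_weight_gt0 n.+1 lamW.
rewrite partial_weightS => h; field; exact: lt0r_neq0.
Qed.

(* Since [- ln (1 - r) <= r / (1 - r)], the partial sums of the ratios dominate
   a multiple of [ln] of the partial weights. *)
Lemma cvgry_sum_ratio (R : realType) (lam : nat -> R) :
  W0 lam -> partial_weight lam n @[n --> \oo] --> +oo ->
  nonincreasing_seq (fun n => lam n / partial_weight lam n) ->
  partial_weight (fun i => lam i / partial_weight lam i) n @[n --> \oo] --> +oo.
Proof.
move=> lamW Loo mono; have L0 i : 0 < partial_weight lam i by exact: partial_weight_gt0.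
set r := fun i => lam i / partial_weight lam i.
(* The ratio at index 0 is 1, so the constant is taken at index 1; monotonicity gives
   [1 - r 1 <= 1 - r n.+1]. *)
have r1 : 0 < 1 - r 1%N by rewrite ratioSE// divr_gt0.
have step n : (1 - r 1%N) * (ln (partial_weight lam n) - ln (partial_weight lam 0))
    <= partial_weight r n.
  elim: n => [|n IH].
    rewrite subrr mulr0 (partial_weight0 r) divr_ge0 ?(ltW (L0 _))//.
    by case: lamW => /ltW.
  have rn : 0 < 1 - r n.+1 by rewrite ratioSE// divr_gt0.
  have rn1 : r n.+1 <= r 1%N by exact: mono.
  rewrite (partial_weightS r).
  suff : (1 - r 1%N) * (ln (partial_weight lam n.+1) - ln (partial_weight lam n))
      <= r n.+1 by lra.
  rewrite -ln_div ?posrE//.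
  have -> : partial_weight lam n.+1 / partial_weight lam n = (1 - r n.+1)^-1.
    by rewrite ratioSE// invf_div.
  rewrite lnV ?posrE//.
  have h : - ln (1 - r n.+1) * (1 - r n.+1) <= r n.+1.
    have := expR_tangent (ln (1 - r n.+1)) 0.
    by rewrite lnK ?posrE// expR0; lra.
  have w0 : 0 <= - ln (1 - r n.+1).
    rewrite oppr_ge0 ln_le0// gerBl divr_ge0 ?(ltW (L0 _))//; by case: lamW.
  apply: le_trans h; rewrite mulrC ler_wpM2l//; lra.
apply/cvgryPge => A; have /cvgryPge := cvgry_ln Loo.
move=> /(_ (A / (1 - r 1%N) + ln (partial_weight lam 0)))[N _ hN].
exists N => // n /= /hN /= h; apply: le_trans (step n).
rewrite mulrC -ler_pdivrMr//; lra.
Qed.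

(** * Asymptotics of the Gini means of x_i = 1 / Lam_i *)

(** Stolz-Cesaro: with r = lam_(n+1) / Lam_(n+1), the quotient of increments is r / (1 - (1 -
    r)^(1-q)). *)
Lemma cvg_weighted_power_sum (R : realType) (lam : nat -> R) (eta q : R) :
  (forall n, 0 < lam n) -> partial_weight lam n @[n --> \oo] --> +oo ->
  (lam n / partial_weight lam n) @[n --> \oo] --> eta ->
  0 <= eta -> eta < 1 -> q < 1 ->
  (partial_weight (fun i => lam i * (partial_weight lam i)^-1 `^ q) n /
   partial_weight lam n `^ (1 - q)) @[n --> \oo] --> power_constant eta q.
Proof.
move=> l0 Loo rcv eta0 eta1 q1.
have lamW : W0 lam by split=> // n; exact: ltW.
have L0 i : 0 < partial_weight lam i by exact: partial_weight_gt0.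
have a0 : 0 < 1 - q by lra.
(* The shift skips the ratio at index 0, which is 1, as [cvg_power_constant] asks for ratios below
   1. *)
pose r n := lam n.+1 / partial_weight lam n.+1.
have rE n : 1 - r n = partial_weight lam n / partial_weight lam n.+1 by exact: ratioSE.
have r0 n : 0 < r n by rewrite divr_gt0.
have r1 n : r n < 1 by rewrite -subr_gt0 rE divr_gt0.
have incr n : partial_weight lam n < partial_weight lam n.+1.
  by rewrite partial_weightS ltrDl.
apply: stolz_cesaro.
- by move=> n; apply: gt0_ltr_powR; rewrite ?nnegrE ?ltW.
- exact: cvgry_powR.
- have rcv' : r n @[n --> \oo] --> eta by rewrite -cvg_shiftS in rcv.
  apply: (eq_cvgn _ (cvg_power_constant r0 r1 eta0 eta1 q1 rcv')) => n.
  rewrite partial_weightS addrAC subrr add0r rE.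
  set L := partial_weight lam n.+1; have Lgt0 : 0 < L by exact: L0.
  rewrite powRM ?invr_ge0 ?(ltW (L0 _))//.
  have Lq : 0 < L `^ q by exact: powR_gt0.
  have La : 0 < L `^ (1 - q) by exact: powR_gt0.
  have eV s : L^-1 `^ s = (L `^ s)^-1.
    by rewrite !gt0_powRE ?invr_gt0// lnV ?posrE// mulrN expRN.
  have LE : L = L `^ (1 - q) * L `^ q.
    by rewrite -powRD ?subrK ?powRr1 ?(ltW Lgt0)// gt_eqF// implybT.
  have hL : partial_weight lam n `^ (1 - q) < L `^ (1 - q).
    by apply: gt0_ltr_powR; rewrite ?nnegrE ?ltW.
  rewrite !eV /r -/L {1}LE; field.
  by rewrite !gt_eqF ?subr_gt0.
Qed.

Lemma cvg_gini_mean_inv (R : realType) (lam : nat -> R) (eta p q : R) :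
  (forall n, 0 < lam n) -> partial_weight lam n @[n --> \oo] --> +oo ->
  (lam n / partial_weight lam n) @[n --> \oo] --> eta ->
  0 <= eta -> eta < 1 -> p < 1 -> q < 1 -> (p = q -> p = 0) ->
  (gini_mean p q (fun i : 'I_n.+1 => (partial_weight lam i)^-1) (fun i => lam i)
    * partial_weight lam n) @[n --> \oo] --> gini_constant eta p q.
Proof.
move=> l0 Loo rcv eta0 eta1 p1 q1 pq0.
have lamW : W0 lam by split=> // n; exact: ltW.
have L0 i : 0 < partial_weight lam i by exact: partial_weight_gt0.
rewrite /gini_constant; case: ifPn => [pq|].
- have cvp := cvg_weighted_power_sum l0 Loo rcv eta0 eta1 p1.
  have cvq := cvg_weighted_power_sum l0 Loo rcv eta0 eta1 q1.
  have Kp0 := power_constant_gt0 eta1 p1; have Kq0 := power_constant_gt0 eta1 q1.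
  apply: (eq_cvgn _ (cvg_powR (a := (p - q)^-1) (divr_gt0 Kp0 Kq0)
    (cvgM cvp (cvgV (lt0r_neq0 Kq0) cvq)))) => n /=.
  rewrite (gini_meanE lam (fun i => (partial_weight lam i)^-1))//.
  set L := partial_weight lam n; have Lgt0 : 0 < L by exact: L0.
  set Sp := partial_weight _ n; set Sq := partial_weight (fun i => _ * _ `^ q) n.
  have S0 s : 0 < partial_weight (fun i => lam i * (partial_weight lam i)^-1 `^ s) n.
    by apply/partial_weight_gt0/W0M => // j; rewrite powR_gt0 ?invr_gt0.
  have Sp0 : 0 < Sp by exact: S0.
  have Sq0 : 0 < Sq by exact: S0.
  have La s : 0 < L `^ s by exact: powR_gt0.
  have -> : Sp / L `^ (1 - p) / (Sq / L `^ (1 - q)) = Sp / Sq * L `^ (p - q).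
    have -> : L `^ (p - q) = L `^ (1 - q) / L `^ (1 - p).
      by rewrite -powRB ?(gt_eqF Lgt0) ?implybT//; congr (_ `^ _); ring.
    by field; rewrite !gt_eqF ?La.
  rewrite powRM ?(ltW (La _)) ?(ltW (divr_gt0 Sp0 Sq0))//.
  by rewrite -powRrM divff ?subr_eq0// powRr1 ?(ltW Lgt0).
- rewrite negbK => /eqP pq; have p0 := pq0 pq; rewrite -pq p0.
  (* [D n / partial_weight lam n] is the logarithm of the sequence in question. The increment of D
     is Lam_n (ln Lam_(n+1) - ln Lam_n), which divided by lam_(n+1) is ln (1 - r) (1 - 1/r). *)
  pose D n := partial_weight lam n * ln (partial_weight lam n)
    - partial_weight (fun i => lam i * ln (partial_weight lam i)) n.
  pose r n := lam n.+1 / partial_weight lam n.+1.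
  have rE n : 1 - r n = partial_weight lam n / partial_weight lam n.+1 by exact: ratioSE.
  have r0 n : 0 < r n by rewrite divr_gt0.
  have r1 n : r n < 1 by rewrite -subr_gt0 rE divr_gt0.
  have rcv' : r n @[n --> \oo] --> eta by rewrite -cvg_shiftS in rcv.
  have cvD : (D n / partial_weight lam n) @[n --> \oo] --> carleman_constant eta.
    apply: stolz_cesaro => //.
      by move=> n; rewrite partial_weightS ltrDl.
    apply: (eq_cvgn _ (cvg_carleman_constant r0 r1 eta0 eta1 rcv')) => n.
    rewrite rE ln_div ?posrE// /D !partial_weightS -/(r n).
    have LS : partial_weight lam n + lam n.+1 != 0.
      by rewrite -partial_weightS gt_eqF.
    have dL : partial_weight lam n + lam n.+1 - partial_weight lam n != 0.
      by rewrite addrAC subrr add0r gt_eqF.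
    by rewrite /r partial_weightS; field; rewrite dL LS.
  apply: (eq_cvgn _ (cvg_expR cvD)) => n.
  rewrite (gini_mean00E lam (fun i => (partial_weight lam i)^-1)).
  have -> : partial_weight (fun i => lam i * ln (partial_weight lam i)^-1) n =
      - partial_weight (fun i => lam i * ln (partial_weight lam i)) n.
    by rewrite /partial_weight -sumrN; apply: eq_bigr => i _;
      rewrite lnV ?posrE ?L0// mulrN.
  rewrite -[X in _ = _ * X]lnK ?posrE// -expRD; congr expR.
  by rewrite /D; field; rewrite gt_eqF.
Qed.

(** * The cut-off test sequence and the lower bound *)

(* Beyond [n] the terms [lam i * cutoff i] telescope to at most the inverse of
   the [n]-th partial weight. *)
Definition cutoff (R : realType) (lam : nat -> R) (n i : nat) : R :=
  if (i <= n)%N then (partial_weight lam i)^-1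
  else (partial_weight lam i * partial_weight lam i.-1)^-1.

Lemma cutoff_sum (R : realType) (lam : nat -> R) n m : W0 lam ->
  partial_weight (fun i => lam i * cutoff lam n i) m
  <= partial_weight (fun i => lam i / partial_weight lam i) n
     + (partial_weight lam 0)^-1.
Proof.
move=> lamW; have L0 i : 0 < partial_weight lam i by exact: partial_weight_gt0.
have l0 i : 0 <= lam i by case: lamW.
set r := fun i => lam i / partial_weight lam i.
have r0 i : 0 <= r i by rewrite divr_ge0 ?(ltW (L0 _)).
(* The extra term 1 / Lam_m carries the induction: it decreases in m, and beyond [n] its decrease is
   exactly the term added to the sum. *)
have step : partial_weight (fun i => lam i * cutoff lam n i) m
    + (partial_weight lam m)^-1
    <= partial_weight r (minn m n) + (partial_weight lam 0)^-1.
  elim: m => [|m IH].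
    by rewrite min0n (partial_weight0 r) (partial_weight0 (fun i => _ * _)) /cutoff.
  have LS := partial_weightS lam m.
  rewrite (partial_weightS (fun i => lam i * cutoff lam n i)).
  case: (leqP m.+1 n) => mn.
    rewrite (minn_idPl (ltnW mn)) in IH.
    rewrite (partial_weightS r) {2}/cutoff mn -/(r m.+1).
    have : (partial_weight lam m.+1)^-1 <= (partial_weight lam m)^-1.
      by rewrite lef_pV2 ?posrE// LS lerDl.
    lra.
  rewrite (minn_idPr _) // in IH.
  rewrite {2}/cutoff leqNgt mn /=.
  have : lam m.+1 / (partial_weight lam m.+1 * partial_weight lam m) =
      (partial_weight lam m)^-1 - (partial_weight lam m.+1)^-1.
    have -> : lam m.+1 = partial_weight lam m.+1 - partial_weight lam m.
      by rewrite LS; ring.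
    by field; rewrite !gt_eqF.
  lra.
have h1 : 0 < (partial_weight lam m)^-1 by rewrite invr_gt0.
have h2 : partial_weight r (minn m n) <= partial_weight r n.
  apply: (@homo_leq _ _ (fun x y => x <= y)) (geq_minr m n) => //.
  - by move=> x y z; exact: le_trans.
  - by move=> i; rewrite partial_weightS lerDl.
lra.
Qed.

(** Up to [n] the cut-off sequence has the means [G k], so the partial sum of lam_k G_k is at most c
    (R_n + 1 / Lam_0), with R_n the sum of the ratios. Dividing by R_n, which tends to infinity,
    removes the constant. *)
Lemma gini_constant_le_hardy_bound (R : realType) (lam : nat -> R)
    (eta p q c : R) :
  W0 lam -> partial_weight lam n @[n --> \oo] --> +oo ->
  nonincreasing_seq (fun n => lam n / partial_weight lam n) ->
  (lam n / partial_weight lam n) @[n --> \oo] --> eta ->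
  0 <= eta -> eta < 1 -> p < 1 -> q < 1 -> (p = q -> p = 0) ->
  hardy_bounds (gini_mean p q) lam c%:E -> gini_constant eta p q <= c.
Proof.
move=> lamW Loo mono rcv eta0 eta1 p1 q1 pq0 hc.
have l0 := weight_gt0 lamW Loo mono.
have L0 i : 0 < partial_weight lam i by exact: partial_weight_gt0.
pose r := fun i => lam i / partial_weight lam i.
have r0 i : 0 < r i by rewrite divr_gt0.
have rW : W0 r by split=> // i; exact: ltW.
have R0 i : 0 < partial_weight r i by exact: partial_weight_gt0.
have Roo := cvgry_sum_ratio lamW Loo mono.
pose G n := gini_mean p q (fun i : 'I_n.+1 => (partial_weight lam i)^-1)
  (fun i => lam i).
have W_le n : partial_weight (fun k => lam k * G k) n
    <= c * (partial_weight r n + (partial_weight lam 0)^-1).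
  have x0 i : 0 < cutoff lam n i.
    by rewrite /cutoff; case: ifP => _; rewrite invr_gt0 ?mulr_gt0.
  have GE k : (k <= n)%N -> G k =
      gini_mean p q (fun i : 'I_k.+1 => cutoff lam n i) (fun i => lam i).
    move=> kn; rewrite /G.
    suff -> : (fun i : 'I_k.+1 => cutoff lam n i) =
              (fun i : 'I_k.+1 => (partial_weight lam i)^-1) by [].
    by apply/funext => i; rewrite /cutoff (leq_trans (leq_ord i) kn).
  have -> : partial_weight (fun k => lam k * G k) n = partial_weight (fun k =>
      lam k * gini_mean p q (fun i : 'I_k.+1 => cutoff lam n i) (fun i => lam i)) n.
    by apply: eq_bigr => k _; rewrite GE// leq_ord.
  exact: (hardy_bounds_partial (@gini_mean_ge0 R p q) lamW x0 hc
    (fun m => cutoff_sum n m lamW) n).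
(* The quotient of increments is lam_n G_n / (lam_n / Lam_n) = G_n Lam_n, whose limit is known. *)
have cvW : (partial_weight (fun k => lam k * G k) n / partial_weight r n)
    @[n --> \oo] --> gini_constant eta p q.
  apply: stolz_cesaro => //.
    by move=> n; rewrite partial_weightS ltrDl.
  have := cvg_gini_mean_inv l0 Loo rcv eta0 eta1 p1 q1 pq0.
  rewrite -cvg_shiftS; apply: eq_cvgn => n.
  rewrite !partial_weightS ![_ + _ - _]addrAC !subrr !add0r /= -/(G n.+1) /r.
  rewrite -partial_weightS.
  by field; rewrite !gt_eqF.
have cvc : (c + c * (partial_weight lam 0)^-1 * (partial_weight r n)^-1)
    @[n --> \oo] --> c.
  rewrite -[X in _ --> X]addr0; apply: cvgD; first exact: cvg_cst.
  rewrite -[X in _ --> X](mulr0 (c * (partial_weight lam 0)^-1)).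
  apply: cvgM; first exact: cvg_cst.
  by apply/gtr0_cvgV0 => //; exact: nearW.
apply: ler_cvg_to cvW cvc _; apply: nearW => n.
rewrite ler_pdivrMr// mulrDl mulfVK ?lt0r_neq0//.
by rewrite -mulrDr; exact: W_le.
Qed.

(** * The Hardy constant from the two bounds *)

Theorem corollary5p6 (R : realType) (lam : nat -> R) (eta p q : R)
    (lam_W0 : W0 lam)
    (Lam_infty : partial_weight lam n @[n --> \oo] --> +oo)
    (ratio_noninc : nonincreasing_seq (fun n => lam n / partial_weight lam n))
    (ratio_cvg : (lam n / partial_weight lam n) @[n --> \oo] --> eta)
    (eta_ge0 : 0 <= eta) (eta_lt1 : eta < 1)
    (min_le0 : Num.min p q <= 0)
    (max_ge0 : 0 <= Num.max p q) (max_lt1 : Num.max p q < 1) :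
  is_hardy_constant (gini_mean p q) lam
    (if p != q then
       if 0 < eta then
         ((1 - (1 - eta) `^ (1 - q)) / (1 - (1 - eta) `^ (1 - p)))
           `^ (p - q)^-1
       else ((1 - q) / (1 - p)) `^ (p - q)^-1
     else (* here min_le0 and max_ge0 force p = q = 0 *)
       if 0 < eta then (1 - eta) `^ (1 - eta^-1)
       else expR 1)%:E.
Proof.
have /andP[p1 q1] : (p < 1) && (q < 1) by rewrite -gt_max.
have pq0 : p = q -> p = 0.
  by move=> pq; move: min_le0 max_ge0; rewrite -pq minxx maxxx; lra.
rewrite -gini_constantE//; split.
- apply: gini_constant_hardy_bound => // n.
  (* A nonincreasing sequence stays above its limit, so every ratio is at least [eta]. *)
  by rewrite -(cvg_lim _ ratio_cvg)//; apply: nonincreasing_cvgn_ge => //;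
    apply/cvg_ex; exists eta.
(* Competing bounds are extended reals: +oo is trivial, -oo is impossible, and the real case is the
   lower bound. *)
- move=> [c||] hc; last 2 first.
  + by rewrite leey.
  + by have := hardy_bounds_gtNy (@gini_mean_ge0 R p q) lam_W0 hc.
  rewrite lee_fin.
  exact: (gini_constant_le_hardy_bound lam_W0 Lam_infty ratio_noninc ratio_cvg).
Qed.
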